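(* Fix $s\in X$. (1) For every $N\ge1$, $$R_N(s)\ge\sum_{k=0}^{N-1}\frac{m^k}{u_{2k+1}(s)-u_{2k}(s)},$$ with the convention that a zero denominator gives the corresponding term the value $+\infty$. Equivalently, $$\mathrm{Cap}_N(s)\le\left(\sum_{k=0}^{N-1}\frac{m^k}{u_{2k+1}(s)-u_{2k}(s)}\right)^{-1}.$$ (2) Define $$S(s):=\sum_{k=0}^{\infty}\frac{m^k}{u_{2k+1}(s)-u_{2k}(s)}\in(0,\infty].$$ If $S(s)=\infty$, then $R_N(s)\to\infty$ and $\mathrm{Cap}_N(s)\to0$ as $N\to\infty$.
   Context: Let $X$ be a set, $m\ge1$ an integer, and $\varphi_1,\dots,\varphi_m:X\to X$ maps. A kernel $J:X\times X\to\mathbb{C}$ is positive definite if $\sum_{\alpha,\beta}\overline{c_\alpha}c_\beta J(s_\alpha,s_\beta)\ge0$ for all finite families $(c_\alpha,s_\alpha)\in\mathbb{C}\times X$; $J_1\le J_2$ means that $J_2-J_1$ is positive definite. The pullback operator is $(LJ)(s,t):=\sum_{i=1}^m J(\varphi_i(s),\varphi_i(t))$. Fix a positive definite kernel $K$ on $X$ with $LK\ge K$. Set $K_0:=K$, $K_{n+1}:=LK_n$ for $n\ge0$, and $u_n(s):=K_n(s,s)$; one has $K_{n+1}\ge K_n$ and $u_{n+1}(s)\ge u_n(s)$. Words: $W_n:=\{1,\dots,m\}^n$, $W_0=\{\emptyset\}$, $W_*:=\bigcup_{n\ge0}W_n$; for $w=i_1\cdots i_n\in W_n$, $|w|=n$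 and $\varphi_w:=\varphi_{i_n}\circ\cdots\circ\varphi_{i_1}$ (with $\varphi_\emptyset=\mathrm{id}$). Network at $s\in X$: consider the rooted $m$-ary tree with vertex set $W_*$, root $\emptyset$, and edges $(w,wi)$, $w\in W_*$, $i\in\{1,\dots,m\}$. Put $a_s(w):=u_{|w|+1}(\varphi_w(s))-u_{|w|}(\varphi_w(s))\ge0$ and give the edge $e=(w,wi)$ the conductance $c_s(e):=a_s(w)/m^{|w|+1}$. A unit flow to depth $N\ge1$ is a nonnegative function $\theta$ on the edges $(w,wi)$ with $|w|\le N-1$ such that $\sum_{i=1}^m\theta(\emptyset,i)=1$ and, for every vertex $w$ with $0<|w|<N$, $\theta(w^-,w)=\sum_{i=1}^m\theta(w,wi)$, where $w^-$ is the parent of $w$. Its energy is $\mathcal{E}_s(\theta):=\sum_e\theta(e)^2/c_s(e)\in[0,\infty]$, summed over all edges up to depth $N$; when $c_s(e)=0$ the term is $+\infty$ if $\theta(e)>0$ and $0$ if $\theta(e)=0$. Define $R_N(s):=\inf\{\mathcal{E}_s(\theta):\theta\text{ a unit flow to depth }N\}$ and $\mathrm{Cap}_N(s):=1/R_N(s)$, with $1/\infty=0$. *)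

(* Defs.v *)
From mathcomp Require Import all_boot all_order all_algebra.
From mathcomp Require Import all_classical all_reals all_analysis.
From mathcomp Require Import complex.

Set Implicit Arguments.
Unset Strict Implicit.
Unset Printing Implicit Defensive.

Import Order.TTheory GRing.Theory Num.Theory.
Import numFieldNormedType.Exports.

Local Open Scope ring_scope.
Local Open Scope complex_scope.

(* In R[i], [0 <= z] means that z is real and nonnegative. *)
Definition posdef (R : realType) (X : Type) (J : X -> X -> R[i]) : Prop :=
  forall (n : nat) (c : 'I_n -> R[i]) (s : 'I_n -> X),
    0 <= \sum_(a < n) \sum_(b < n) Num.conj (c a) * c b * J (s a) (s b).

Definition kernel_le (R : realType) (X : Type) (J1 J2 : X -> X -> R[i]) :
    Prop :=
  posdef (fun s t => J2 s t - J1 s t).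

Definition pullback (R : realType) (X : Type) (m : nat) (phi : 'I_m -> X -> X)
    (J : X -> X -> R[i]) : X -> X -> R[i] :=
  fun s t => \sum_(i < m) J (phi i s) (phi i t).

Definition kernel_iter (R : realType) (X : Type) (m : nat)
    (phi : 'I_m -> X -> X) (K : X -> X -> R[i]) (n : nat) : X -> X -> R[i] :=
  iter n (pullback phi) K.

(* The diagonal of a positive definite kernel is real, so taking the real part
   loses nothing. *)
Definition diag_iter (R : realType) (X : Type) (m : nat) (phi : 'I_m -> X -> X)
    (K : X -> X -> R[i]) (n : nat) (s : X) : R :=
  complex.Re (kernel_iter phi K n s s).

(* phi_w = phi_{i_n} o ... o phi_{i_1} for w = i_1 ... i_n: the first letter
   acts first. *)
Definition word_map (X : Type) (m : nat) (phi : 'I_m -> X -> X)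
    (w : seq 'I_m) (s : X) : X :=
  foldl (fun x i => phi i x) s w.

Definition increment (R : realType) (X : Type) (m : nat) (phi : 'I_m -> X -> X)
    (K : X -> X -> R[i]) (s : X) (w : seq 'I_m) : R :=
  diag_iter phi K (size w).+1 (word_map phi w s)
  - diag_iter phi K (size w) (word_map phi w s).

(* The edge (w, wi) of the m-ary tree is encoded by the pair w, i. *)
Definition conductance (R : realType) (X : Type) (m : nat)
    (phi : 'I_m -> X -> X) (K : X -> X -> R[i]) (s : X)
    (w : seq 'I_m) (i : 'I_m) : R :=
  increment phi K s w / m%:R ^+ (size w).+1.

(* theta w i is the flow through (w, wi); its values on edges with
   size w >= N are unconstrained and do not enter the energy to depth N. *)
Definition unit_flow (R : realType) (m N : nat)
    (theta : seq 'I_m -> 'I_m -> R) : Prop :=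
  [/\ forall w i, (size w < N)%N -> 0 <= theta w i,
      \sum_(i < m) theta [::] i = 1
    & forall w j, (size (rcons w j) < N)%N ->
        theta w j = \sum_(i < m) theta (rcons w j) i].

Local Open Scope ereal_scope.

(* On \bar R one has 0^-1 = +oo, +oo^-1 = 0, x * +oo = +oo for x > 0 and
   0 * +oo = 0, which are the conventions wanted for edges of conductance 0,
   for terms with zero denominator and for the capacity. *)
Definition energy (R : realType) (X : Type) (m : nat) (phi : 'I_m -> X -> X)
    (K : X -> X -> R[i]) (s : X) (N : nat) (theta : seq 'I_m -> 'I_m -> R) :
    \bar R :=
  \sum_(k < N) \sum_(w : k.-tuple 'I_m) \sum_(i < m)
    (theta w i ^+ 2)%:E / (conductance phi K s w i)%:E.

Definition resistance (R : realType) (X : Type) (m : nat)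
    (phi : 'I_m -> X -> X) (K : X -> X -> R[i]) (s : X) (N : nat) : \bar R :=
  ereal_inf [set energy phi K s N theta | theta in unit_flow N]%classic.

Definition capacity (R : realType) (X : Type) (m : nat) (phi : 'I_m -> X -> X)
    (K : X -> X -> R[i]) (s : X) (N : nat) : \bar R :=
  (resistance phi K s N)^-1.

Definition level_term (R : realType) (X : Type) (m : nat)
    (phi : 'I_m -> X -> X) (K : X -> X -> R[i]) (s : X) (k : nat) : \bar R :=
  (m%:R ^+ k)%:E
  / (diag_iter phi K k.*2.+1 s - diag_iter phi K k.*2 s)%:E.

(* Main.v *)
Require Import Defs.
From mathcomp Require Import all_boot all_order all_algebra.
From mathcomp Require Import all_classical all_reals all_analysis.
From mathcomp Require Import complex.
From mathcomp Require Import ring.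

(** The resistance is bounded below one level at a time. A unit flow sends
    total flow 1 through the edges leaving the words of length [k], so by the
    Cauchy--Schwarz inequality ([inve_sum_le_energy]) the energy spent there is
    at least the inverse of the total conductance of that level; this is the
    Nash-Williams bound for the cut made of these edges.

    The total conductance of level [k] is computed exactly
    ([sum_conductance]). Iterating the rule that [u_{n+1}] at a point is the
    sum of [u_n] over its images under the maps [phi_i] gives that the sum of
    [u_n] at the points [phi_w(s)], over the words [w] of length [k], is
    [u_{n+k}(s)]. Hence the increments [a_s(w)] add up to
    [u_{2k+1}(s) - u_{2k}(s)] and the conductances to this number divided by
    [m ^ k], so that level [k] costs at least the [k]-th term of the series.

    Every term of the series is positive, possibly infinite, because
    [u_{n+1} - u_n >= 0]; when the series diverges the resistances dominate
    its partial sums and tend to infinity, and their inverses tend to zero. *)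

Set Implicit Arguments.
Unset Strict Implicit.

Import Order.TTheory GRing.Theory Num.Theory.
Import numFieldNormedType.Exports.

Local Open Scope classical_set_scope.
Local Open Scope ring_scope.
Local Open Scope complex_scope.
Local Open Scope ereal_scope.

(** * Sums over words *)

(** Both the flow and the diagonals of the iterated kernels propagate from a
    word to its one-letter extensions on the right; this reindexing turns such
    a one-step rule into a rule for the sum over a whole level. *)
Lemma sum_words_rcons (V : nmodType) (m n : nat) (F : seq 'I_m -> V) :
  (\sum_(w : n.+1.-tuple 'I_m) F w =
   \sum_(w : n.-tuple 'I_m) \sum_(i < m) F (rcons w i))%R.
Proof.
rewrite pair_big /=.
rewrite (reindex (fun p : n.-tuple 'I_m * 'I_m => [tuple of rcons p.1 p.2])) //=.
exists (fun w : n.+1.-tuple 'I_m =>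
  ([tuple of belast (thead w) (behead w)], last (thead w) (behead w))).
  move=> [w i] _; congr pair.
    apply: val_inj => /=; rewrite /thead (tnth_nth i) /=.
    by case: w => -[|x w] //= _; rewrite belast_rcons.
  rewrite /thead (tnth_nth i) /=.
  by case: w => -[|x w] //= _; rewrite last_rcons.
move=> w _; apply: val_inj => /=.
by case/tupleP: w => x w /=; rewrite theadE -lastI.
Qed.

Lemma sum_words0 (V : nmodType) (m : nat) (F : seq 'I_m -> V) :
  (\sum_(w : 0.-tuple 'I_m) F w = F [::])%R.
Proof.
rewrite (big_pred1 [tuple]) => [//|w /=].
by apply/esym/eqP/val_inj; rewrite tuple0.
Qed.

(** * The diagonals of the iterated kernels *)

Section Diagonals.
Context (R : realType) (X : Type) (m : nat) (phi : 'I_m -> X -> X).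
Context (K : X -> X -> R[i]).

Local Notation u := (diag_iter phi K).

Lemma diag_iterS (n : nat) (x : X) : u n.+1 x = (\sum_(i < m) u n (phi i x))%R.
Proof. by rewrite /diag_iter /= raddf_sum. Qed.

Lemma sum_words_diag_iter (n k : nat) (s : X) :
  (\sum_(w : k.-tuple 'I_m) u n (word_map phi w s) = u (n + k) s)%R.
Proof.
elim: k n => [|k IHk] n.
  by rewrite (sum_words0 (fun w => u n (word_map phi w s))) addn0.
rewrite (sum_words_rcons _ (fun w => u n (word_map phi w s))).
rewrite addnS -addSn -IHk; apply: eq_bigr => w _.
by rewrite diag_iterS; apply: eq_bigr => i _; rewrite /word_map foldl_rcons.
Qed.

(** Each level of the tree sees the increment of the diagonals at twice its
    depth: one factor [k] comes from the kernel index, the other from the sum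
    over the words of length [k]. *)
Lemma sum_words_increment (k : nat) (s : X) :
  (\sum_(w : k.-tuple 'I_m) increment phi K s w = u k.*2.+1 s - u k.*2 s)%R.
Proof.
rewrite -addnn -addSn -2!sum_words_diag_iter -sumrB.
by apply: eq_bigr => w _; rewrite /increment size_tuple.
Qed.

Hypothesis LK_ge_K : kernel_le K (pullback phi K).

(** On the diagonal, positive definiteness with a single point says that
    [u_1 - u_0] is nonnegative; the higher increments are sums of this one over
    words. *)
Lemma diag_iter_leS (n : nat) (x : X) : (u n x <= u n.+1 x)%R.
Proof.
rewrite -[n]add0n -addSn -2!sum_words_diag_iter; apply: ler_sum => w _.
move: (word_map phi w x) => y.
have := @LK_ge_K 1%N (fun=> 1%R) (fun=> y).
rewrite !big_ord1 rmorph1 !mul1r.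
by rewrite lecE raddfB => /andP[_] /=; rewrite raddfB subr_ge0.
Qed.

Lemma increment_ge0 (s : X) (w : seq 'I_m) : (0 <= increment phi K s w)%R.
Proof. by rewrite subr_ge0 diag_iter_leS. Qed.

Lemma conductance_ge0 (s : X) (w : seq 'I_m) (i : 'I_m) :
  (0 <= conductance phi K s w i)%R.
Proof. by rewrite divr_ge0 ?increment_ge0 ?exprn_ge0. Qed.

Lemma sum_conductance (k : nat) (s : X) : (0 < m)%N ->
  (\sum_(w : k.-tuple 'I_m) \sum_(i < m) conductance phi K s w i =
   (u k.*2.+1 s - u k.*2 s) / m%:R ^+ k)%R.
Proof.
move=> m_gt0; rewrite -sum_words_increment mulr_suml; apply: eq_bigr => w _.
rewrite sumr_const card_ord /conductance size_tuple -mulr_natr exprS.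
have m_neq0 : (m%:R != 0 :> R)%R by rewrite pnatr_eq0 -lt0n.
by field; rewrite mul1r expf_neq0.
Qed.

End Diagonals.

(** * The energy of one level *)

(** The tangent line at [x = t c] to the convex function [x ^ 2 / c] lies below
    it. For [c = 0] the right-hand side is [+oo] unless [x = 0], and then both
    sides vanish, so the degenerate edges need no separate treatment later. *)
Lemma tangent_le_sqr_div (R : realType) (t x c : R) : (0 <= c)%R ->
  (2 * t * x - t ^+ 2 * c)%:E <= (x ^+ 2)%:E / c%:E.
Proof.
rewrite le_eqVlt => /predU1P[<-|c_gt0].
  rewrite inver eqxx; have [->|x_neq0] := eqVneq x 0%R.
    by rewrite expr0n mul0e !mulr0 subr0.
  by rewrite gt0_muley ?leey // lte_fin exprn_even_gt0.
rewrite inver gt_eqF // -EFinM lee_fin ler_pdivlMr // -subr_ge0.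
have -> : (x ^+ 2 - (2 * t * x - t ^+ 2 * c) * c = (x - t * c) ^+ 2)%R by ring.
exact: sqr_ge0.
Qed.

(** The Cauchy--Schwarz inequality for a unit of flow through finitely many
    parallel conductors. Summing the tangent inequality with a common slope [t]
    bounds the energy below by [2 t - t ^ 2 C], where [C] is the total
    conductance: the choice [t = 1 / C] is optimal, and for [C = 0] the bound
    is unbounded in [t]. *)
Lemma inve_sum_le_energy (R : realType) (T : finType) (x c : T -> R) :
  (forall e, 0 <= c e)%R -> (\sum_e x e = 1)%R ->
  ((\sum_e c e)%R%:E)^-1 <= \sum_e (x e ^+ 2)%:E / (c e)%:E.
Proof.
move=> c_ge0 x1; set C := (\sum_e c e)%R.
have tangent t : (2 * t - t ^+ 2 * C)%:E <= \sum_e (x e ^+ 2)%:E / (c e)%:E.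
  have -> : (2 * t - t ^+ 2 * C = \sum_e (2 * t * x e - t ^+ 2 * c e))%R.
    by rewrite sumrB -!mulr_sumr x1 mulr1.
  by rewrite -sumEFin; apply: lee_sum => e _; exact: tangent_le_sqr_div.
rewrite inver; have [C0|C_neq0] := eqVneq C 0%R.
  rewrite leye_eq; apply/eqP/eqyP => A _.
  by have := tangent (A / 2)%R; rewrite C0 mulr0 subr0 mulrC divfK.
have := tangent C^-1%R.
by have -> : (2 * C^-1 - C^-1 ^+ 2 * C = C^-1)%R by field.
Qed.

Section Levels.
Context (R : realType) (X : Type) (m : nat) (m_ge1 : (1 <= m)%N).
Context (phi : 'I_m -> X -> X) (K : X -> X -> R[i]).
Hypothesis LK_ge_K : kernel_le K (pullback phi K).

(** By conservation at the vertices, the edges of each level carry the same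
    total flow as the edges at the root. *)
Lemma unit_flow_level (N k : nat) (theta : seq 'I_m -> 'I_m -> R) :
  unit_flow N theta -> (k < N)%N ->
  (\sum_(w : k.-tuple 'I_m) \sum_(i < m) theta w i = 1)%R.
Proof.
move=> [_ root1 kirchhoff]; elim: k => [|k IHk] kN.
  by rewrite (sum_words0 (fun w => \sum_(i < m) theta w i)%R).
rewrite (sum_words_rcons _ (fun w => \sum_(i < m) theta w i)%R).
rewrite -(IHk (ltnW kN)); apply: eq_bigr => w _; apply: eq_bigr => i _.
by rewrite kirchhoff // size_rcons size_tuple.
Qed.

Lemma level_termE (s : X) (k : nat) :
  level_term phi K s k =
  ((\sum_(w : k.-tuple 'I_m) \sum_(i < m) conductance phi K s w i)%R%:E)^-1.
Proof.
rewrite sum_conductance // /level_term.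
set D := (_ - _)%R; set M := (_ ^+ k)%R.
have M_gt0 : (0 < M)%R by rewrite exprn_gt0 // ltr0n.
rewrite !inver mulf_eq0 invr_eq0 (gt_eqF M_gt0) orbF.
case: ifP => _; first by rewrite gt0_muley.
by rewrite -EFinM invfM invrK mulrC.
Qed.

Lemma level_term_gt0 (s : X) (k : nat) : 0 < level_term phi K s k.
Proof.
rewrite /level_term inver.
have M_gt0 : (0 < m%:R ^+ k :> R)%R by rewrite exprn_gt0 // ltr0n.
case: eqP => [_|/eqP D_neq0]; first by rewrite gt0_muley.
rewrite -EFinM lte_fin divr_gt0 // lt0r D_neq0 subr_ge0.
exact: diag_iter_leS.
Qed.

Lemma level_term_le_energy (s : X) (N k : nat)
    (theta : seq 'I_m -> 'I_m -> R) : unit_flow N theta -> (k < N)%N ->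
  level_term phi K s k <=
  \sum_(w : k.-tuple 'I_m) \sum_(i < m)
    (theta w i ^+ 2)%:E / (conductance phi K s w i)%:E.
Proof.
move=> flow kN; rewrite level_termE !pair_big /=.
apply: (@inve_sum_le_energy _ _
  (fun p : k.-tuple 'I_m * 'I_m => theta p.1 p.2)) => [p|].
  exact: conductance_ge0.
by rewrite -(pair_big predT predT (fun w i => theta (tval w) i)) /=
  (unit_flow_level flow).
Qed.

Lemma sum_level_term_le_resistance (s : X) (N : nat) :
  \sum_(0 <= k < N) level_term phi K s k <= resistance phi K s N.
Proof.
apply: le_ereal_inf_tmp => _ [theta flow <-].
rewrite big_mkord; apply: lee_sum => k _.
by apply: level_term_le_energy; last exact: ltn_ord.
Qed.

Lemma sum_level_term_ge0 (s : X) (N : nat) :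
  0 <= \sum_(0 <= k < N) level_term phi K s k.
Proof. by apply: sume_ge0 => k _; exact/ltW/level_term_gt0. Qed.

End Levels.

(** * Inverses of divergent sequences *)

Lemma cvge_inve_pinfty (R : realType) (f : nat -> \bar R) :
  f N @[N --> \oo] --> +oo -> (f N)^-1 @[N --> \oo] --> 0.
Proof.
move=> /cvgeyPge fy.
have small (e : R) : (0 < e)%R -> \forall N \near \oo, 0 <= (f N)^-1 <= e%:E.
  move=> e_gt0; near=> N.
  have fN : e^-1%:E <= f N by near: N; exact: fy.
  have e'_ge0 : 0 <= e^-1%:E by rewrite lee_fin invr_ge0 ltW.
  have f_ge0 := le_trans e'_ge0 fN.
  rewrite inve_ge0 f_ge0 /= inve_ple ?inE ?lee_fin ?(ltW e_gt0) //.
  by rewrite inver gt_eqF.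
apply/fine_cvgP; split.
  near=> N; have /andP[f0 f1] : 0 <= (f N)^-1 <= 1%:E.
    by near: N; exact: small.
  by rewrite ge0_fin_numE // (le_lt_trans f1) ?ltry.
apply/cvgr0Pnorm_le => e e_gt0; near=> N.
have /andP[f0 fe] : 0 <= (f N)^-1 <= e%:E by near: N; exact: small.
have f_fin : (f N)^-1 \is a fin_num.
  by rewrite ge0_fin_numE // (le_lt_trans fe) ?ltry.
by rewrite /= ger0_norm ?fine_ge0 // -lee_fin fineK.
Unshelve. all: by end_near.
Qed.

(** * Lower bounds and limits for the resistance *)

Theorem theorem2p11 (R : realType) (X : Type) (m : nat) (m_ge1 : (1 <= m)%N)
    (phi : 'I_m -> X -> X) (K : X -> X -> R[i])
    (K_posdef : posdef K) (LK_ge_K : kernel_le K (pullback phi K)) (s : X) :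
  (forall N : nat, (1 <= N)%N ->
     \sum_(0 <= k < N) level_term phi K s k <= resistance phi K s N
     /\ capacity phi K s N <= (\sum_(0 <= k < N) level_term phi K s k)^-1)
  /\ 0 < \sum_(0 <= k <oo) level_term phi K s k
  /\ (\sum_(0 <= k <oo) level_term phi K s k = +oo ->
      resistance phi K s N @[N --> \oo] --> +oo
      /\ capacity phi K s N @[N --> \oo] --> 0).
Proof.
have sum_le := sum_level_term_le_resistance m_ge1 LK_ge_K s.
have sum_ge0 := sum_level_term_ge0 m_ge1 LK_ge_K s.
have term_gt0 := level_term_gt0 m_ge1 LK_ge_K s.
have term_ge0 k : (0 <= k)%N -> true -> 0 <= level_term phi K s k.
  by move=> _ _; exact/ltW.
split=> [N _|].
  by split=> //; rewrite lee_pV2 ?inE // (le_trans (sum_ge0 N)).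
split.
  apply: (lt_le_trans (term_gt0 0%N)).
  by have := nneseries_lim_ge 1 term_ge0; rewrite big_nat1.
move=> sum_y.
have resistance_y : resistance phi K s N @[N --> \oo] --> +oo.
  apply: (gee_cvgy (nearW _ sum_le)).
  by rewrite -sum_y; exact: is_cvg_nneseries term_ge0.
by split=> //; exact: cvge_inve_pinfty.
Qed.
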